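(* For all probability measures $\mu_1,\mu_2$ on $E$ and all $s,t,T\in I$ with $0\le s\le s+1\le t\le T$, \[ \left\|\mu_1 K_{s,t}^T-\mu_2 K_{s,t}^T\right\|_{TV}\le \prod_{k=0}^{\lfloor t-s\rfloor-1}\bigl(1-d_{t-k}\bigr)\,\|\mu_1-\mu_2\|_{TV} \] and \[ \left\|\Phi_{s,t}(\mu_1)-\Phi_{s,t}(\mu_2)\right\|_{TV}\le 2\prod_{k=0}^{\lfloor t-s\rfloor-1}\bigl(1-d_{t-k}\bigr). \]
   Context: Let $I=[0,+\infty)$ or $I=\mathbb{N}$. Let $(X_t)_{t\in I}$ be a (possibly time-inhomogeneous) Markov process with values in a measurable space $(E,\mathcal E)$, defined on $(\Omega,(\mathcal F_{s,t})_{0\le s\le t\in I},\mathbb P)$, with $X_t$ being $\mathcal F_{s,r}$-measurable for all $s\le t\le r$. For $s\in I$ and a probability measure $\mu$ on $E$, $\mathbb P_{s,\mu}$ (resp. $\mathbb P_{s,x}$ when $\mu=\delta_x$) denotes the law of the process $(X_t)_{t\ge s}$ started at time $s$ with distribution $\mu$, and $\mathbb E_{s,\mu}$ the corresponding expectation. Let $\{Z_{s,t}: s\le t,\ s,t\in I\}$ be nonnegative random variables with $Z_{s,t}$ $\mathcal F_{s,t}$-measurable, multiplicative ($Z_{s,r}Z_{r,t}=Z_{s,t}$ for $s\le r\le t$), and such that $\mathbb E_{s,x}(Z_{s,t})>0$ and $\sup_{y\in E}\mathbb E_{s,y}(Z_{s,t})<\infty$ for all $s\le t$ in $I$ and $x\in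 E$. For a probability measure $\mu$ and $s\le t$, $\Phi_{s,t}(\mu)$ is the probability measure with $\Phi_{s,t}(\mu)(f)=\mathbb E_{s,\mu}(f(X_t)Z_{s,t})/\mathbb E_{s,\mu}(Z_{s,t})$ for bounded measurable $f$. For $s\in I$, $s\ge 1$, and $x_1,x_2\in E$, let $\nu_{s,x_1,x_2}=\min_{i=1,2}\Phi_{s-1,s}(\delta_{x_i})$ (the largest measure smaller than both measures) and \[ d_s=\inf_{t\ge 0,\ x_1,x_2\in E}\frac{\mathbb E_{s,\nu_{s,x_1,x_2}}(Z_{s,s+t})}{\sup_{x\in E}\mathbb E_{s,x}(Z_{s,s+t})},\] where $\mathbb E_{s,\nu}(\cdot)=\int\mathbb E_{s,x}(\cdot)\nu(dx)$ for a nonnegative measure $\nu$. For $0\le s\le t\le T$ and bounded measurable $f$, $K^T_{s,t}f(x)=\mathbb E_{s,x}(f(X_t)Z_{s,T})/\mathbb E_{s,x}(Z_{s,T})$ and $\mu K^T_{s,t}f=\int_E K^T_{s,t}f(x)\mu(dx)$. For a finite signed measure $\mu$, $\|\mu\|_{TV}=\sup_{A\in\mathcal E}\mu(A)-\inf_{A\in\mathcal E}\mu(A)$. *)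

(* Defs.v *)
From HB Require Import structures.
From mathcomp Require Import all_boot all_order all_algebra.
From mathcomp Require Import all_classical all_reals all_analysis measurable_realfun.
Set Implicit Arguments. Unset Strict Implicit. Unset Printing Implicit Defensive.
Import Order.TTheory GRing.Theory Num.Theory.
Local Open Scope classical_set_scope.
Local Open Scope ring_scope.

Definition Itime {R : realType} (discrete : bool) : set R :=
  if discrete then [set x | exists n : nat, x = n%:R] else [set x | 0 <= x].

Section Defs.
Context {R : realType} {dO dE : measure_display}
  {Omega : measurableType dO} {E : measurableType dE}.

Definition Ex (P : R -> E -> probability Omega R) (s : R) (x : E)
  (h : Omega -> \bar R) : \bar R := (\int[P s x]_w h w)%E.

Definition Exmu (P : R -> E -> probability Omega R) (s : R)
  (nu : {measure set E -> \bar R}) (h : Omega -> \bar R) : \bar R :=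
  (\int[nu]_x Ex P s x h)%E.

Definition Phi (P : R -> E -> probability Omega R) (X : R -> Omega -> E)
  (Z : R -> R -> Omega -> R) (s t : R) (mu : {measure set E -> \bar R})
  (A : set E) : \bar R :=
  (Exmu P s mu (fun w => (\1_A (X t w) * Z s t w)%:E) *
   (Exmu P s mu (fun w => (Z s t w)%:E))^-1)%E.

Definition muK (P : R -> E -> probability Omega R) (X : R -> Omega -> E)
  (Z : R -> R -> Omega -> R) (s t T : R) (mu : {measure set E -> \bar R})
  (A : set E) : \bar R :=
  (\int[mu]_x (Ex P s x (fun w => (\1_A (X t w) * Z s T w)%:E) *
               (Ex P s x (fun w => (Z s T w)%:E))^-1))%E.

Definition tv (m1 m2 : set E -> \bar R) : \bar R :=
  (ereal_sup [set (m1 A - m2 A)%E | A in measurable] -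
   ereal_inf [set (m1 A - m2 A)%E | A in measurable])%E.

Definition is_meas_min (nu : {measure set E -> \bar R})
  (m1 m2 : set E -> \bar R) : Prop :=
  (forall A, measurable A -> (nu A <= m1 A)%E /\ (nu A <= m2 A)%E) /\
  (forall nu' : {measure set E -> \bar R},
     (forall A, measurable A -> (nu' A <= m1 A)%E /\ (nu' A <= m2 A)%E) ->
     forall A, measurable A -> (nu' A <= nu A)%E).

Definition dcoef (discrete : bool) (P : R -> E -> probability Omega R)
  (X : R -> Omega -> E) (Z : R -> R -> Omega -> R) (s : R) : \bar R :=
  ereal_inf [set r | exists (t : R) (x1 x2 : E) (nu : {measure set E -> \bar R}),
    [/\ t \in Itime discrete,
        is_meas_min nu (Phi P X Z (s - 1) s (\d_x1)) (Phi P X Z (s - 1) s (\d_x2)) &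
        r = (Exmu P s nu (fun w => (Z s (s + t) w)%:E) *
             (ereal_sup [set Ex P s y (fun w => (Z s (s + t) w)%:E) | y in setT])^-1)%E]].

Definition penalized_markov (discrete : bool) (X : R -> Omega -> E)
  (F : R -> R -> set (set Omega)) (P : R -> E -> probability Omega R)
  (Z : R -> R -> Omega -> R) : Prop :=
  let I := Itime discrete in
  (
      (forall s t, s \in I -> t \in I -> s <= t ->
         sigma_algebra setT (F s t) /\ F s t `<=` measurable) /\
      (forall s s' t t', s \in I -> s' \in I -> t \in I -> t' \in I ->
         s' <= s -> s <= t -> t <= t' -> F s t `<=` F s' t') /\
      (forall s t r, s \in I -> t \in I -> r \in I -> s <= t -> t <= r ->
         forall B, measurable B -> F s r (X t @^-1` B)) /\
      (forall s A, s \in I -> measurable A ->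
         measurable_fun [set: E] ((fun x => P s x A) : E -> \bar R)) /\
      (forall s x B, s \in I -> measurable B ->
         P s x (X s @^-1` B) = (\1_B x)%:E) /\
      (forall s u t x A B, s \in I -> u \in I -> t \in I -> s <= u -> u <= t ->
         F s u A -> F u t B ->
         P s x (A `&` B) = (\int[P s x]_(w in A) P u (X u w) B)%E) /\
      [/\ (forall s t w, s \in I -> t \in I -> s <= t -> 0 <= Z s t w),
          (forall s t, s \in I -> t \in I -> s <= t ->
             forall B, measurable B -> F s t (Z s t @^-1` B)),
          (forall s r t w, s \in I -> r \in I -> t \in I -> s <= r -> r <= t ->
             Z s r w * Z r t w = Z s t w),
          (forall s t x, s \in I -> t \in I -> s <= t ->
             (0 < Ex P s x (fun w => (Z s t w)%:E))%E) &
          (forall s t, s \in I -> t \in I -> s <= t ->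
             exists M : R, forall y, (Ex P s y (fun w => (Z s t w)%:E) <= M%:E)%E)]).

End Defs.

(* Main.v *)
(* For u between s and t, the Markov and multiplicative properties give
   K^T_{s,t} f (x) = Phi_{s,u}(delta_x)(g k) / Phi_{s,u}(delta_x)(g) with
   g y = E_{u,y}(Z_{u,T}) and k = K^T_{u,t} f, so K^T_{s,t} f is a weighted average of
   K^T_{u,t} f and its oscillation does not increase as s decreases. When u = s + 1,
   both measures Phi_{s,u}(delta_{x_i}) dominate their minimum nu, so the two averages
   share at least the mass nu(g) / sup g >= d_u and the oscillation shrinks by the
   factor 1 - d_u. Hence K^T_{s,t} 1_A has oscillation at most the product. The first
   bound then follows by a Hahn decomposition of mu1 - mu2, and the second because
   Phi_{s,t}(mu)(A) is an average of K^t_{s,t} 1_A. *)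
Require Import Defs.
From HB Require Import structures.
From mathcomp Require Import all_boot all_order all_algebra.
From mathcomp Require Import all_classical all_reals all_analysis measurable_realfun.
From mathcomp Require Import ring lra.
Import Order.TTheory GRing.Theory Num.Theory.
Local Open Scope classical_set_scope.
Local Open Scope ring_scope.

Set Implicit Arguments.
Unset Strict Implicit.
Unset Printing Implicit Defensive.

(** * Monotone functionals on nonnegative measurable functions *)

(** The properties of an integral that a monotone class argument uses. Iterated integrals and
    integrals against densities share them, so two such expressions can be compared through their
    values on indicators alone. *)
Definition ge0_functional (R : realType) (d : measure_display)
    (T : measurableType d) (Phi : (T -> \bar R) -> \bar R) : Prop :=
  [/\ forall f g : T -> \bar R,
        measurable_fun setT f -> (forall x, 0 <= f x)%E ->
        measurable_fun setT g -> (forall x, 0 <= g x)%E ->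
        Phi (fun x => f x + g x)%E = (Phi f + Phi g)%E,
      forall (r : R) (f : T -> \bar R), 0 <= r ->
        measurable_fun setT f -> (forall x, 0 <= f x)%E ->
        Phi (fun x => r%:E * f x)%E = (r%:E * Phi f)%E,
      forall f : T -> \bar R, measurable_fun setT f ->
        (forall x, 0 <= f x)%E -> (0 <= Phi f)%E &
      forall (f_ : nat -> T -> \bar R) (f : T -> \bar R),
        (forall n, measurable_fun setT (f_ n)) ->
        (forall n x, 0 <= f_ n x)%E ->
        (forall x, {homo f_ ^~ x : n m / (n <= m)%N >-> (n <= m)%E}) ->
        (forall x, f_ ^~ x @ \oo --> f x) ->
        (fun n => Phi (f_ n)) @ \oo --> Phi f].

Section functional.
Context (R : realType).

Import HBNNSimple.

Lemma ge0_functional_sum d (T : measurableType d) (Phi : (T -> \bar R) -> \bar R)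
    (I : Type) (s : seq I) (c : I -> R) (A : I -> set T) :
  ge0_functional Phi -> (forall i, 0 <= c i) -> (forall i, measurable (A i)) ->
  Phi (fun x => \sum_(i <- s) (c i)%:E * (\1_(A i) x)%:E)%E =
  (\sum_(i <- s) (c i)%:E * Phi (fun x => (\1_(A i) x)%:E))%E.
Proof.
move=> [PD PZ P0 _] c0 mA.
have mi i : measurable_fun setT (fun x => (\1_(A i) x)%:E : \bar R).
  exact/measurable_EFinP/measurable_indic.
have i0 i x : (0 <= (\1_(A i) x)%:E :> \bar R)%E by rewrite lee_fin.
elim: s => [|i s IH].
  (* [Phi] vanishes at the zero function by homogeneity with scalar 0. *)
  rewrite big_nil -[RHS](mul0e (Phi (fun=> 0%E))) -PZ//.
  by congr Phi; apply/funext => x; rewrite big_nil mul0e.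
rewrite big_cons -IH -PZ// -PD.
- by congr Phi; apply/funext => x; rewrite big_cons.
- exact: measurable_funeM.
- by move=> x; rewrite mule_ge0// lee_fin.
- by apply: emeasurable_sum => k; exact: measurable_funeM.
- by move=> x; apply: sume_ge0 => k _; rewrite mule_ge0// lee_fin.
Qed.

(** The inequality passes from indicators to simple functions by additivity and homogeneity, then to
    [f] along an increasing sequence of simple functions. *)
Lemma le_ge0_functional d (T : measurableType d)
    (Phi Psi : (T -> \bar R) -> \bar R) (f : T -> \bar R) :
  ge0_functional Phi -> ge0_functional Psi ->
  (forall A, measurable A ->
     Phi (fun x => (\1_A x)%:E) <= Psi (fun x => (\1_A x)%:E))%E ->
  measurable_fun setT f -> (forall x, 0 <= f x)%E -> (Phi f <= Psi f)%E.
Proof.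
move=> PhiF PsiF le mf f0.
pose g := nnsfun_approx measurableT mf.
(* [ge0_functional_sum] asks for a nonnegative coefficient at every index, hence [Num.max y 0]; on
   the range of [g n] it is just [y]. *)
have gE n : (fun x => (g n x)%:E) = (fun x =>
    \sum_(y <- finmap.enum_fset (fset_set (range (g n))))
      (Num.max y 0)%:E * (\1_(g n @^-1` [set y]) x)%:E)%E.
  apply/funext => x; rewrite fimfunE fsbig_finite//= -sumEFin.
  apply: eq_big_seq => y; rewrite in_fset_set// inE => -[z _ <-].
  by rewrite EFinM max_l.
have leg n : (Phi (fun x => (g n x)%:E) <= Psi (fun x => (g n x)%:E))%E.
  have c0 (y : R) : 0 <= Num.max y 0 by rewrite le_max lexx orbT.
  rewrite gE !(ge0_functional_sum _ _ c0)//.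
  apply: lee_sum => i _; apply: lee_wpmul2l; last exact: le.
  by rewrite lee_fin.
have mg n : measurable_fun setT (fun x => (g n x)%:E) by exact/measurable_EFinP.
have g0 n x : (0 <= (g n x)%:E)%E by rewrite lee_fin.
have nd x : {homo (fun n x => (g n x)%:E) ^~ x : n m / (n <= m)%N >-> (n <= m)%E}.
  by move=> n m nm; rewrite lee_fin; exact/lefP/nd_nnsfun_approx.
have cg x : (fun n => (g n x)%:E) @ \oo --> f x.
  exact: (cvg_nnsfun_approx measurableT mf (fun x _ => f0 x)).
case: PhiF PsiF => [_ _ _ Pc] [_ _ _ Qc].
have c1 := Pc _ _ mg g0 nd cg; have c2 := Qc _ _ mg g0 nd cg.
rewrite -(cvg_lim _ c1)// -(cvg_lim _ c2)//; apply: lee_lim.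
- by apply/cvg_ex; exists (Phi f).
- by apply/cvg_ex; exists (Psi f).
- exact: nearW.
Qed.

Lemma eq_ge0_functional d (T : measurableType d)
    (Phi Psi : (T -> \bar R) -> \bar R) (f : T -> \bar R) :
  ge0_functional Phi -> ge0_functional Psi ->
  (forall A, measurable A ->
     Phi (fun x => (\1_A x)%:E) = Psi (fun x => (\1_A x)%:E))%E ->
  measurable_fun setT f -> (forall x, 0 <= f x)%E -> Phi f = Psi f.
Proof.
move=> PhiF PsiF PQ mf f0; apply/eqP; rewrite eq_le.
by rewrite !le_ge0_functional// => A mA; rewrite PQ.
Qed.

Lemma ge0_functional_integral d (T : measurableType d)
    (mu : {measure set T -> \bar R}) :
  ge0_functional (fun f => \int[mu]_x f x)%E.
Proof.
split.
- by move=> f g mf f0 mg g0; exact: ge0_integralD.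
- by move=> r f r0 mf f0; exact: ge0_integralZl_EFin.
- by move=> f _ f0; exact: integral_ge0.
- move=> f_ f mf f0 nd cf.
  have -> : (\int[mu]_x f x = \int[mu]_x limn (f_ ^~ x))%E.
    by apply: eq_integral => x _; apply/esym/cvg_lim => //; exact: cf.
  exact: cvg_monotone_convergence.
Qed.

Lemma ge0_functional_comp d d' (T : measurableType d) (U : measurableType d')
    (Phi : (T -> \bar R) -> \bar R) (h : T -> U) :
  measurable_fun setT h -> ge0_functional Phi ->
  ge0_functional (fun f => Phi (fun x => f (h x))).
Proof.
move=> mh [PD PZ P0 Pc].
have mc (f : U -> \bar R) : measurable_fun setT f ->
  measurable_fun setT (fun x => f (h x)) by move=> mf; exact: measurableT_comp.
split.
- by move=> f g mf f0 mg g0; apply: PD => //; exact: mc.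
- by move=> r f r0 mf f0; apply: PZ => //; exact: mc.
- by move=> f mf f0; apply: P0 => //; exact: mc.
- by move=> f_ f mf f0 nd cf; apply: Pc => // n; exact: mc.
Qed.

Lemma ge0_functional_mul d (T : measurableType d)
    (Phi : (T -> \bar R) -> \bar R) (g : T -> R) :
  measurable_fun setT g -> (forall x, 0 <= g x) -> ge0_functional Phi ->
  ge0_functional (fun f => Phi (fun x => (g x)%:E * f x)%E).
Proof.
move=> mg g0 [PD PZ P0 Pc].
have mc (f : T -> \bar R) : measurable_fun setT f ->
    measurable_fun setT (fun x => (g x)%:E * f x)%E.
  by move=> mf; apply: emeasurable_funM => //; exact/measurable_EFinP.
have c0 (f : T -> \bar R) : (forall x, 0 <= f x)%E ->
    (forall x, 0 <= (g x)%:E * f x)%E.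
  by move=> f0 x; rewrite mule_ge0// lee_fin.
split.
- move=> f f' mf f0 mf' f'0; rewrite -PD//; [|exact: mc|exact: c0|exact: mc|exact: c0].
  by congr Phi; apply/funext => x; rewrite ge0_muleDr.
- move=> r f r0 mf f0; rewrite -PZ//; [|exact: mc|exact: c0].
  by congr Phi; apply/funext => x; rewrite muleCA.
- by move=> f mf f0; apply: P0; [exact: mc|exact: c0].
- move=> f_ f mf f0 nd cf; apply: Pc.
  + by move=> n; exact: mc.
  + by move=> n x; exact: c0.
  + by move=> x n m nm; apply: lee_wpmul2l; [rewrite lee_fin|exact: nd].
  + by move=> x; apply: cvgeZl => //; exact: cf.
Qed.

Lemma measurable_fun_kernel_integral d d' (T : measurableType d)
    (U : measurableType d') (k : T -> {measure set U -> \bar R})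
    (f : U -> \bar R) :
  (forall A, measurable A -> measurable_fun setT (fun x => k x A)) ->
  measurable_fun setT f -> (forall x, 0 <= f x)%E ->
  measurable_fun setT (fun x => \int[k x]_y f y)%E.
Proof.
move=> mk mf f0; pose g := nnsfun_approx measurableT mf.
apply: (@measurable_fun_preimage_integral _ _ _ _ _ f g).
- by move=> n m nm; apply/nd_nnsfun_approx.
- exact: (cvg_nnsfun_approx measurableT mf (fun x _ => f0 x)).
- move=> n r; exact: mk.
Qed.

(** This covers the right-hand side of the Markov property, where an inner expectation started from
    [X u] is integrated over the past. *)
Lemma ge0_functional_kernel d d' (T : measurableType d)
    (U : measurableType d') (k : T -> {measure set U -> \bar R})
    (Phi : (T -> \bar R) -> \bar R) :
  (forall A, measurable A -> measurable_fun setT (fun x => k x A)) ->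
  ge0_functional Phi ->
  ge0_functional (fun f => Phi (fun x => \int[k x]_y f y)%E).
Proof.
move=> mk [PD PZ P0 Pc].
have c0 (f : U -> \bar R) : (forall x, 0 <= f x)%E ->
    (forall x, 0 <= \int[k x]_y f y)%E.
  by move=> f0 x; exact: integral_ge0.
have mc := measurable_fun_kernel_integral mk.
split.
- move=> f g mf f0 mg g0; rewrite -PD; [|exact: mc|exact: c0|exact: mc|exact: c0].
  by congr Phi; apply/funext => x; exact: ge0_integralD.
- move=> r f r0 mf f0; rewrite -PZ//; [|exact: mc|exact: c0].
  by congr Phi; apply/funext => x; exact: ge0_integralZl_EFin.
- by move=> f mf f0; apply: P0; [exact: mc|exact: c0].
- move=> f_ f mf f0 nd cf; apply: Pc.
  + by move=> n; exact: mc.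
  + by move=> n x; exact: c0.
  + move=> x n m nm; apply: ge0_le_integral => // y _; exact: nd.
  + move=> x; have [_ _ _] := ge0_functional_integral (k x); exact.
Qed.

End functional.

(** * Finite values on bounded integrands *)

Section functional_real.
Context (R : realType) (d : measure_display) (T : measurableType d).

(** The values at [f] and at [M - f] are nonnegative and add up to the finite number [M * Phi 1]. *)
Lemma ge0_functional_fin_num (Phi : (T -> \bar R) -> \bar R) (f : T -> R) (M : R) :
  ge0_functional Phi -> Phi (fun=> 1%E) \is a fin_num ->
  measurable_fun setT f -> (forall x, 0 <= f x <= M) ->
  Phi (fun x => (f x)%:E) \is a fin_num.
Proof.
move=> [PD PZ P0 _] fin mf fM.
have M0 : 0 <= M by have /andP[] := fM point; exact: le_trans.
have f0 x : (0 <= (f x)%:E)%E by rewrite lee_fin; case/andP: (fM x).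
have f1 x : (0 <= (M - f x)%:E)%E.
  by rewrite lee_fin subr_ge0; case/andP: (fM x).
have mf1 : measurable_fun setT (fun x => (f x)%:E) by exact/measurable_EFinP.
have mf2 : measurable_fun setT (fun x => (M - f x)%:E).
  by apply/measurable_EFinP; exact: measurable_funB.
have E : (Phi (fun x => (f x)%:E) + Phi (fun x => (M - f x)%:E) =
    M%:E * Phi (fun=> 1))%E.
  rewrite -PD// -PZ//; congr Phi; apply/funext => x.
  by rewrite -EFinD mule1; congr EFin; ring.
have fin2 : (M%:E * Phi (fun=> 1))%E \is a fin_num by rewrite fin_numM.
move: fin2; rewrite -E fin_numD => /andP[]//.
Qed.

(** Names real numbers for the mass [G] of the weight [g] and the weighted integral [K] of [k], so
    that later estimates on weighted averages [K / G] are plain real arithmetic. The gaps [b - k]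
    and [k - a] are kept because, being nonnegative, they can be compared under domination of
    measures. *)
Lemma ge0_functional_between (Phi : (T -> \bar R) -> \bar R) (g k : T -> R)
    (a b M : R) :
  ge0_functional Phi -> Phi (fun=> 1%E) \is a fin_num ->
  measurable_fun setT g -> (forall x, 0 <= g x <= M) ->
  measurable_fun setT k -> 0 <= a -> (forall x, a <= k x <= b) ->
  exists G K : R, [/\ Phi (fun x => (g x)%:E) = G%:E,
    Phi (fun x => (k x * g x)%:E) = K%:E,
    Phi (fun x => ((b - k x) * g x)%:E) = (b * G - K)%:E,
    Phi (fun x => ((k x - a) * g x)%:E) = (K - a * G)%:E &
    a * G <= K <= b * G].
Proof.
move=> PF fin mg gM mk a0 kab.
have [PD PZ P0 _] := PF.
have M0 : 0 <= M by have /andP[] := gM point; exact: le_trans.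
have b0 : 0 <= b by have /andP[] := kab point; lra.
have finf (f : T -> R) : measurable_fun setT f -> (forall x, 0 <= f x <= b) ->
    Phi (fun x => (f x * g x)%:E) \is a fin_num.
  move=> mf fb; apply: (ge0_functional_fin_num (M := b * M) PF fin).
    exact: measurable_funM.
  move=> x; have /andP[? ?] := gM x; have /andP[? ?] := fb x.
  by rewrite mulr_ge0//= ler_pM.
have mk1 : measurable_fun setT (fun x => b - k x) by exact: measurable_funB.
have mk2 : measurable_fun setT (fun x => k x - a) by exact: measurable_funB.
have fg : Phi (fun x => (g x)%:E) \is a fin_num.
  exact: (ge0_functional_fin_num PF fin mg gM).
have fk : Phi (fun x => (k x * g x)%:E) \is a fin_num.
  by apply: finf => // x; have /andP[] := kab x; lra.
have f1 : Phi (fun x => ((b - k x) * g x)%:E) \is a fin_num.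
  by apply: finf => // x; have /andP[] := kab x; lra.
have f2 : Phi (fun x => ((k x - a) * g x)%:E) \is a fin_num.
  by apply: finf => // x; have /andP[] := kab x; lra.
have ge0 (f : T -> R) : (forall x, 0 <= f x) -> (forall x, 0 <= (f x * g x)%:E)%E.
  by move=> f0 x; rewrite lee_fin mulr_ge0//; case/andP: (gM x).
have mE (f : T -> R) : measurable_fun setT f ->
    measurable_fun setT (fun x => (f x * g x)%:E).
  by move=> mf; apply/measurable_EFinP; exact: measurable_funM.
have k0 x : 0 <= k x by have /andP[] := kab x; lra.
have k1 x : 0 <= b - k x by have /andP[] := kab x; lra.
have k2 x : 0 <= k x - a by have /andP[] := kab x; lra.
have g0 x : (0 <= (g x)%:E)%E by rewrite lee_fin; case/andP: (gM x).
have mgE : measurable_fun setT (fun x => (g x)%:E) by exact/measurable_EFinP.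
have E1 : (Phi (fun x => ((b - k x) * g x)%:E) + Phi (fun x => (k x * g x)%:E) =
    b%:E * Phi (fun x => (g x)%:E))%E.
  rewrite -PD; [|exact: mE|exact: ge0|exact: mE|exact: ge0].
  rewrite -PZ//; congr Phi; apply/funext => x.
  by rewrite -EFinD -EFinM; congr EFin; ring.
have E2 : (Phi (fun x => ((k x - a) * g x)%:E) + a%:E * Phi (fun x => (g x)%:E) =
    Phi (fun x => (k x * g x)%:E))%E.
  rewrite -PZ// -PD; [|exact: mE|exact: ge0| |].
  - by congr Phi; apply/funext => x; rewrite -EFinM -EFinD; congr EFin; ring.
  - exact: measurable_funeM.
  - by move=> x; rewrite mule_ge0// lee_fin.
have P1 := P0 _ (mE _ mk1) (ge0 _ k1).
have P2 := P0 _ (mE _ mk2) (ge0 _ k2).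
move: E1 E2 P1 P2; move/fineK: fg => <-; move/fineK: fk => <-.
move/fineK: f1 => <-; move/fineK: f2 => <-.
rewrite -!EFinM -!EFinD => -[E1] -[E2]; rewrite !lee_fin => P1 P2.
do 2 eexists; split; [reflexivity|reflexivity|congr EFin; lra|congr EFin; lra|].
lra.
Qed.

End functional_real.

(** * Minimum of two measures and total variation *)

Section measures.
Context (R : realType) (d : measure_display) (T : measurableType d).

(** [D] is the positive set of a Hahn decomposition of the charge [m1 - m2]. *)
Lemma Hahn_finite_measures (m1 m2 : {finite_measure set T -> \bar R}) :
  exists D : set T, [/\ measurable D,
    forall B, measurable B -> B `<=` D -> (m2 B <= m1 B)%E &
    forall B, measurable B -> B `<=` ~` D -> (m1 B <= m2 B)%E].
Proof.
pose nu := cadd (charge_of_finite_measure m1)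
                (cscale (-1) (charge_of_finite_measure m2)).
have nuE B : nu B = (m1 B - m2 B)%E.
  by rewrite /nu /cadd/= /cscale/= EFinN mulN1e.
have [D [N [[mD pD] [mN nN] DN DN0]]] := Hahn_decomposition nu.
have fin (m : {finite_measure set T -> \bar R}) B : measurable B ->
  m B \is a fin_num by exact: fin_num_measure.
exists D; split => // B mB BD.
- have : (0 <= nu B)%E := pD B mB BD.
  by rewrite nuE sube_ge0// fin.
- have BN : B `<=` N.
    move=> x /BD nDx; have : (D `|` N) x by rewrite DN.
    by case.
  have : (nu B <= 0)%E := nN B mB BN.
  by rewrite nuE sube_le0.
Qed.

(** The minimum is [m2] on the Hahn set, where [m2] is the smaller one, and [m1] off it. It is the
    largest minorant because any other one can be split along the same set. *)
Lemma meas_min_exists (m1 m2 : {finite_measure set T -> \bar R}) :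
  exists nu : {measure set T -> \bar R}, is_meas_min nu m1 m2.
Proof.
have [D [mD D21 D12]] := Hahn_finite_measures m1 m2.
have mDc : measurable (~` D) by exact: measurableC.
pose nu : {measure set T -> \bar R} := measure_add (mrestr m2 mD) (mrestr m1 mDc).
have nuE A : nu A = (m2 (A `&` D) + m1 (A `&` ~` D))%E by exact: measure_addE.
exists nu.
have split_ (m : {measure set T -> \bar R}) A : measurable A ->
    m A = (m (A `&` D) + m (A `&` ~` D))%E.
  move=> mA; rewrite -measureU//; [|exact: measurableI|exact: measurableI|].
    by rewrite -setIUr setUv setIT.
  by rewrite setIACA setICr setI0.
split=> [A mA|nu' nu'le A mA]; rewrite nuE.
- have mAD : measurable (A `&` D) by exact: measurableI.
  have mADc : measurable (A `&` ~` D) by exact: measurableI.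
  rewrite (split_ m1 _ mA) (split_ m2 _ mA); split; apply: leeD => //.
  + by apply: D21 => //; exact: subIsetr.
  + by apply: D12 => //; exact: subIsetr.
- rewrite (split_ nu' _ mA); apply: leeD.
    by have [] := nu'le _ (measurableI _ _ mA mD).
  by have [] := nu'le _ (measurableI _ _ mA mDc).
Qed.

Lemma integral_bounded_EFin (m : {measure set T -> \bar R}) (f : T -> R) (M : R) :
  (m setT <= 1)%E -> measurable_fun setT f -> (forall x, 0 <= f x <= M) -> 0 <= M ->
  exists2 r : R, 0 <= r <= M & (\int[m]_x (f x)%:E)%E = r%:E.
Proof.
move=> m1 mf fM M0.
have ge0 : (0 <= \int[m]_x (f x)%:E)%E.
  by apply: integral_ge0 => x _; rewrite lee_fin; case/andP: (fM x).
have leM : (\int[m]_x (f x)%:E <= M%:E)%E.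
  apply: (@le_trans _ _ (\int[m]_x M%:E)%E).
    apply: ge0_le_integral => //.
    - by move=> x _; rewrite lee_fin; case/andP: (fM x).
    - exact/measurable_EFinP.
    - by move=> x _; rewrite lee_fin; case/andP: (fM x).
  rewrite integral_cst//= -[leRHS]mule1; apply: lee_wpmul2l => //.
exists (fine (\int[m]_x (f x)%:E)%E); last first.
  by rewrite fineK// ge0_fin_numE// (le_lt_trans leM) ?ltry.
rewrite fine_ge0//= -lee_fin fineK// ge0_fin_numE// (le_lt_trans leM)//.
exact: ltry.
Qed.

(** Raising [f] to [a + c] on [D] and lowering it to [a] off [D] turns it into [a + c * \1_D], and
    the changes [u] and [v] only help: [m1] gives [u] at least as much mass as [m2] does, and [v] at
    most as much. Writing this as [f + u = a + c * \1_D + v] keeps every integrand nonnegative. *)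
Lemma integral_diff_le (m1 m2 : probability T R) (D : set T) (f : T -> R)
    (a c : R) :
  measurable D ->
  (forall B, measurable B -> B `<=` D -> (m2 B <= m1 B)%E) ->
  (forall B, measurable B -> B `<=` ~` D -> (m1 B <= m2 B)%E) ->
  measurable_fun setT f -> 0 <= a -> 0 <= c -> (forall x, a <= f x <= a + c) ->
  (\int[m1]_x (f x)%:E - \int[m2]_x (f x)%:E <= c%:E * (m1 D - m2 D))%E.
Proof.
move=> mD D21 D12 mf a0 c0 fac.
have mDc : measurable (~` D) by exact: measurableC.
pose u x := \1_D x * (a + c - f x) : R.
pose v x := \1_(~` D) x * (f x - a) : R.
have muf : measurable_fun setT (fun x => a + c - f x).
  by apply: measurable_funB.
have mvf : measurable_fun setT (fun x => f x - a).
  by apply: measurable_funB.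
have mu : measurable_fun setT u by apply: measurable_funM.
have mv : measurable_fun setT v.
  by apply: measurable_funM => //; exact: measurable_indic.
have fE x : f x + u x = a + c * \1_D x + v x.
  by rewrite /u /v !indicE in_setC; case: (x \in D) => /=; ring.
have f0 x : 0 <= f x <= a + c by have /andP[] := fac x; lra.
have u0 x : 0 <= u x <= a + c.
  rewrite /u indicE; have /andP[] := fac x.
  by case: (x \in D); rewrite ?mulr1n ?mulr0n ?mul1r ?mul0r; lra.
have v0 x : 0 <= v x <= a + c.
  rewrite /v indicE; have /andP[] := fac x.
  by case: (x \in ~` D); rewrite ?mulr1n ?mulr0n ?mul1r ?mul0r; lra.
have ac0 : 0 <= a + c by lra.
have cD x : 0 <= c * \1_D x by rewrite mulr_ge0.
have key (m : probability T R) : (\int[m]_x (f x)%:E + \int[m]_x (u x)%:E =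
    a%:E + c%:E * m D + \int[m]_x (v x)%:E)%E.
  rewrite -ge0_integralD//=; first last.
  - exact/measurable_EFinP.
  - by move=> x _; rewrite lee_fin; case/andP: (u0 x).
  - exact/measurable_EFinP.
  - by move=> x _; rewrite lee_fin; case/andP: (f0 x).
  under eq_integral do rewrite -EFinD fE EFinD.
  have mcD : measurable_fun setT (fun x => c * \1_D x : R).
    by apply: measurable_funM.
  rewrite ge0_integralD//=; first last.
  - exact/measurable_EFinP.
  - by move=> x _; rewrite lee_fin; case/andP: (v0 x).
  - by apply/measurable_EFinP; apply: measurable_funD.
  - by move=> x _; rewrite lee_fin addr_ge0.
  congr (_ + _)%E.
  under eq_integral do rewrite EFinD.
  rewrite ge0_integralD//=; last first.
  - exact/measurable_EFinP.
  - by move=> x _; rewrite lee_fin.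
  rewrite integral_cst//= probability_setT mule1; congr (_ + _)%E.
  under eq_integral do rewrite EFinM.
  rewrite ge0_integralZl_EFin//; first by rewrite integral_indic// setIT.
  exact/measurable_EFinP/measurable_indic.
(* Domination on the subsets of [B] compares the functionals with density [\1_B] on indicators,
   hence on all nonnegative functions. *)
have restr_le (B : set T) (h : T -> R) (n1 n2 : probability T R) :
    measurable B -> (forall A, measurable A -> A `<=` B -> (n1 A <= n2 A)%E) ->
    measurable_fun setT h -> (forall x, 0 <= h x) ->
    (\int[n1]_x (\1_B x * h x)%:E <= \int[n2]_x (\1_B x * h x)%:E)%E.
  move=> mB n12 mh h0.
  have i0 x : 0 <= \1_B x :> R by [].
  have F (n : probability T R) :=
    ge0_functional_mul (measurable_indic mB) i0 (ge0_functional_integral n).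
  apply: (le_ge0_functional (f := fun x => (h x)%:E) (F n1) (F n2)).
  - move=> A mA.
    have E (n : probability T R) :
        (\int[n]_x ((\1_B x)%:E * (\1_A x)%:E) = n (B `&` A))%E.
      rewrite -[in RHS](setIT (B `&` A)) -integral_indic//; last exact: measurableI.
      by apply: eq_integral => x _; rewrite indicI.
    by rewrite !E; apply: n12; [exact: measurableI|exact: subIsetl].
  - exact/measurable_EFinP.
  - by move=> x; rewrite lee_fin.
have leu : (\int[m2]_x (u x)%:E <= \int[m1]_x (u x)%:E)%E.
  by apply: restr_le => // x; have /andP[] := fac x; lra.
have lev : (\int[m1]_x (v x)%:E <= \int[m2]_x (v x)%:E)%E.
  by apply: restr_le => // x; have /andP[] := fac x; lra.
have le1 (m : probability T R) : (m setT <= 1)%E by rewrite probability_setT.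
have [F1 _ E1] := integral_bounded_EFin (le1 m1) mf f0 ac0.
have [F2 _ E2] := integral_bounded_EFin (le1 m2) mf f0 ac0.
have [U1 _ EU1] := integral_bounded_EFin (le1 m1) mu u0 ac0.
have [U2 _ EU2] := integral_bounded_EFin (le1 m2) mu u0 ac0.
have [V1 _ EV1] := integral_bounded_EFin (le1 m1) mv v0 ac0.
have [V2 _ EV2] := integral_bounded_EFin (le1 m2) mv v0 ac0.
have := key m1; have := key m2.
have /fineK <- : m1 D \is a fin_num by exact: fin_num_measure.
have /fineK <- : m2 D \is a fin_num by exact: fin_num_measure.
move: leu lev; rewrite E1 E2 EU1 EU2 EV1 EV2 !lee_fin => leu lev.
rewrite -!(EFinM, EFinD, EFinB) => -[k2] -[k1].
lra.
Qed.

(** The supremum and minus the infimum contribute [x] each, whence the factor 2. *)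
Lemma tv_le (m1 m2 : set T -> \bar R) (x : R) :
  (forall A, measurable A -> - x%:E <= m1 A - m2 A <= x%:E)%E ->
  (tv m1 m2 <= (2 * x)%:E)%E.
Proof.
move=> H; rewrite /tv (_ : 2 * x = x + x); last by ring.
rewrite EFinD; apply: leeD.
  by apply: ge_ereal_sup => _ [A mA <-]; case/andP: (H A mA).
rewrite leeNl; apply: le_ereal_inf_tmp => _ [A mA <-].
by case/andP: (H A mA).
Qed.

(** Both masses are 1, so the difference on the complement of [D] is the opposite of that on [D];
    one set bounds the supremum, the other the infimum. *)
Lemma tv_ge (m1 m2 : probability T R) (D : set T) :
  measurable D -> (2%:E * (m1 D - m2 D) <= tv m1 m2)%E.
Proof.
move=> mD.
have fD (m : probability T R) : m D = (fine (m D))%:E.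
  by rewrite fineK//; exact: fin_num_measure.
rewrite (_ : 2%:E * _ = (m1 D - m2 D) - (m1 (~` D) - m2 (~` D)))%E; last first.
  rewrite !probability_setC// (fD m1) (fD m2).
  by rewrite -!(EFinD, EFinB, EFinM); congr EFin; ring.
apply: leeB.
  by apply: ereal_sup_ubound; exists D.
by apply: ereal_inf_lbound; exists (~` D) => //; exact: measurableC.
Qed.

End measures.

(** * Penalized Markov processes *)

Section process.
Context {R : realType} {dO dE : measure_display}
  {Omega : measurableType dO} {E : measurableType dE} {discrete : bool}
  {X : R -> Omega -> E} {F : R -> R -> set (set Omega)}
  {P : R -> E -> probability Omega R} {Z : R -> R -> Omega -> R}.
Hypothesis PM : penalized_markov discrete X F P Z.
Local Notation I := (Itime discrete : set R).

(** * Time index, measurability and the Markov property for products *)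

Lemma ItimeB (a b : R) : a \in I -> b \in I -> b <= a -> a - b \in I.
Proof.
rewrite /Itime; case: discrete; rewrite !inE /=; last by rewrite subr_ge0.
move=> [n ->] [m ->]; rewrite ler_nat => mn; exists (n - m)%N.
by rewrite natrB.
Qed.

Lemma Itime_nat (n : nat) : (n%:R : R) \in I.
Proof. by rewrite /Itime; case: discrete; rewrite inE //=; exists n. Qed.

Lemma measurable_filtration (s t : R) : s \in I -> t \in I -> s <= t ->
  F s t `<=` measurable.
Proof. by move=> sI tI st; case: PM => H _; have [] := H s t sI tI st. Qed.

Lemma measurable_adapted (s t : R) (Y : Omega -> R) :
  s \in I -> t \in I -> s <= t ->
  (forall B, measurable B -> F s t (Y @^-1` B)) -> measurable_fun setT Y.
Proof.
move=> sI tI st FY _ B mB; rewrite setTI.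
exact/(measurable_filtration sI tI st)/FY.
Qed.

Lemma measurable_X (t : R) : t \in I -> measurable_fun setT (X t).
Proof.
move=> tI _ B mB; rewrite setTI; case: PM => _ [_ [XF _]].
by apply: (measurable_filtration tI tI (lexx t)); exact: XF.
Qed.

Lemma measurable_P (s : R) (A : set Omega) : s \in I -> measurable A ->
  measurable_fun setT (fun x => P s x A).
Proof. by move=> sI mA; case: PM => _ [_ [_ [H _]]]; exact: H. Qed.

Lemma measurable_Ex (s : R) (h : Omega -> \bar R) : s \in I ->
  measurable_fun setT h -> (forall w, 0 <= h w)%E ->
  measurable_fun setT (fun x => Ex P s x h).
Proof.
move=> sI mh h0; apply: (measurable_fun_kernel_integral (k := P s)) => // A mA.
exact: measurable_P.
Qed.

Lemma integral_indicM (mu : {measure set Omega -> \bar R}) (A : set Omega)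
    (f : Omega -> \bar R) : measurable A ->
  (\int[mu]_w ((\1_A w)%:E * f w) = \int[mu]_(w in A) f w)%E.
Proof.
move=> mA; rewrite [RHS]integral_mkcond epatch_indic.
by apply: eq_integral => w _; rewrite muleC.
Qed.

(* The Markov property for events extends, first in the future variable and then
   in the past one, to products: both sides are monotone functionals of each factor. *)
Lemma markov_prod (s u t : R) (x : E) (Y W : Omega -> R) (h : E -> R) :
  s \in I -> u \in I -> t \in I -> s <= u -> u <= t ->
  (forall B, measurable B -> F s u (Y @^-1` B)) -> (forall w, 0 <= Y w) ->
  (forall B, measurable B -> F u t (W @^-1` B)) -> (forall w, 0 <= W w) ->
  (forall y, Ex P u y (fun w => (W w)%:E) = (h y)%:E) ->
  Ex P s x (fun w => (Y w * W w)%:E) = Ex P s x (fun w => (Y w * h (X u w))%:E).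
Proof.
move=> sI uI tI su ut FY Y0 FW W0 hE.
have [Fsig [_ [_ [_ [_ [Mk _]]]]]] := PM.
(* [TA] and [TB] are [Omega] with the sigma-algebras of the past and of the future. A functional on
   [TB] only has to be tested on events of [F u t], the only ones for which the Markov property is
   given. *)
pose TA := g_sigma_algebraType (F s u).
pose TB := g_sigma_algebraType (F u t).
have [sigA subA] := Fsig _ _ sI uI su.
have [sigB subB] := Fsig _ _ uI tI ut.
have mTA : (measurable : set (set TA)) = F s u by exact: sigma_algebra_id.
have mTB : (measurable : set (set TB)) = F u t by exact: sigma_algebra_id.
have mk B : measurable B -> measurable_fun setT (fun w => P u (X u w) B).
  move=> mB; apply: (measurableT_comp (measurable_P uI mB)).
  exact: measurable_X.
have midA : measurable_fun setT (id : Omega -> TA).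
  by move=> _ B; rewrite mTA setTI => /subA.
have midB : measurable_fun setT (id : Omega -> TB).
  by move=> _ B; rewrite mTB setTI => /subB.
have mY : measurable_fun setT Y by exact: (measurable_adapted sI uI).
have mW : measurable_fun setT W by exact: (measurable_adapted uI tI).
have mh : measurable_fun setT h.
  have -> : h = (fun y => fine (Ex P u y (fun w => (W w)%:E))).
    by apply/funext => y; rewrite hE.
  apply: measurableT_comp => //; apply: measurable_Ex => //.
  exact/measurable_EFinP.
have h0 y : 0 <= h y.
  by rewrite -lee_fin -hE; apply: integral_ge0 => w _; rewrite lee_fin.
(* First extension: the past event [A] is fixed and the future event is replaced by [W]. *)
have step A : F s u A ->
    (\int[P s x]_w ((\1_A w)%:E * (W w)%:E) =
     \int[P s x]_w ((\1_A w)%:E * (h (X u w))%:E))%E.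
  move=> FA; have mA := subA _ FA.
  under [RHS]eq_integral do rewrite -hE.
  have i0 w : 0 <= \1_A w :> R by [].
  have PhiF := ge0_functional_mul (measurable_indic mA) i0
    (ge0_functional_integral (P s x)).
  have PsiF := ge0_functional_kernel (k := fun w => P u (X u w)) mk PhiF.
  apply: (eq_ge0_functional (T := TB) (f := fun w => (W w)%:E)
    (ge0_functional_comp midB PhiF) (ge0_functional_comp midB PsiF)).
  - move=> B; rewrite mTB => FB; have mB := subB _ FB.
    rewrite /= !integral_indicM//.
    under [RHS]eq_integral do rewrite integral_indic// setIT.
    by rewrite integral_indic// setIC; apply: (Mk s u t).
  - apply/measurable_EFinP => _ B mB; rewrite setTI mTB; exact: FW.
  - by move=> w; rewrite lee_fin.
rewrite /Ex.
have mhX : measurable_fun setT (fun w => h (X u w)).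
  by apply: (measurableT_comp mh); exact: measurable_X.
have hX0 w : 0 <= h (X u w) by exact: h0.
have PhiF := ge0_functional_mul mW W0 (ge0_functional_integral (P s x)).
have PsiF := ge0_functional_mul mhX hX0 (ge0_functional_integral (P s x)).
(* Second extension: both sides become functionals of the past variable [Y], with densities [W] and
   [h (X u w)]; on indicators they agree by [step]. *)
under eq_integral do rewrite mulrC EFinM.
under [RHS]eq_integral do rewrite mulrC EFinM.
apply: (eq_ge0_functional (T := TA) (f := fun w => (Y w)%:E)
  (ge0_functional_comp midA PhiF) (ge0_functional_comp midA PsiF)).
- move=> A; rewrite mTA => FA /=.
  under eq_integral do rewrite muleC.
  under [RHS]eq_integral do rewrite muleC.
  exact: step.
- apply/measurable_EFinP => _ B mB; rewrite setTI mTA; exact: FY.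
- by move=> w; rewrite lee_fin.
Qed.


(** * Normalising constants and tilted expectations *)

Lemma measurable_Z (s t : R) : s \in I -> t \in I -> s <= t ->
  measurable_fun setT (Z s t).
Proof.
move=> sI tI st; apply: (measurable_adapted sI tI st).
by case: PM => _ [_ [_ [_ [_ [_ [_ H _ _ _]]]]]]; exact: H.
Qed.

Lemma Z_ge0 (s t : R) w : s \in I -> t \in I -> s <= t -> 0 <= Z s t w.
Proof. by case: PM => _ [_ [_ [_ [_ [_ [H _ _ _ _]]]]]]; exact: H. Qed.

(** Taken in [R] so that quotients are real; [weightE] shows that for admissible times [fine] loses
    nothing. *)
Definition weight (s t : R) (x : E) : R := fine (Ex P s x (fun w => (Z s t w)%:E)).

Definition tilted (s t T : R) (A : set E) (x : E) : R :=
  fine (Ex P s x (fun w => (\1_A (X t w) * Z s T w)%:E)).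

(* Integration of f against Phi_{s,u}(delta_x). *)
Definition step (s u : R) (x : E) (f : E -> \bar R) : \bar R :=
  (\int[P s x]_w ((Z s u w / weight s u x)%:E * f (X u w)))%E.

Lemma weightE (s t : R) (x : E) : s \in I -> t \in I -> s <= t ->
  Ex P s x (fun w => (Z s t w)%:E) = (weight s t x)%:E.
Proof.
move=> sI tI st; rewrite /weight fineK//.
case: PM => _ [_ [_ [_ [_ [_ [Z0 _ _ _ H]]]]]].
have [M /(_ x) leM] := H s t sI tI st.
rewrite ge0_fin_numE ?(le_lt_trans leM) ?ltry//.
by apply: integral_ge0 => w _; rewrite lee_fin Z0.
Qed.

Lemma weight_gt0 (s t : R) (x : E) : s \in I -> t \in I -> s <= t ->
  0 < weight s t x.
Proof.
move=> sI tI st; rewrite -lte_fin -weightE//.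
by case: PM => _ [_ [_ [_ [_ [_ [_ _ _ H _]]]]]]; exact: H.
Qed.

Lemma weight_bounded (s t : R) : s \in I -> t \in I -> s <= t ->
  exists M : R, forall x, 0 <= weight s t x <= M.
Proof.
move=> sI tI st; case: PM => _ [_ [_ [_ [_ [_ [_ _ _ _ H]]]]]].
have [M leM] := H s t sI tI st; exists M => x.
by rewrite ltW ?weight_gt0//= -lee_fin -weightE.
Qed.

Lemma measurable_fine_Ex (s : R) (h : Omega -> R) : s \in I ->
  measurable_fun setT h -> (forall w, 0 <= h w) ->
  measurable_fun setT (fun x => fine (Ex P s x (fun w => (h w)%:E))).
Proof.
move=> sI mh h0; apply: measurableT_comp => //; apply: measurable_Ex => //.
exact/measurable_EFinP.
Qed.

Lemma measurable_weight (s t : R) : s \in I -> t \in I -> s <= t ->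
  measurable_fun setT (weight s t).
Proof.
move=> sI tI st; apply: measurable_fine_Ex => //; first exact: measurable_Z.
by move=> w; exact: Z_ge0.
Qed.

Lemma measurable_indicZ (s t T : R) (A : set E) :
  s \in I -> t \in I -> T \in I -> s <= T -> measurable A ->
  measurable_fun setT (fun w => \1_A (X t w) * Z s T w).
Proof.
move=> sI tI TI sT mA; apply: measurable_funM; last exact: measurable_Z.
by apply: (measurableT_comp (measurable_indic mA)); exact: measurable_X.
Qed.

Lemma indicZ_ge0 (s t T : R) (A : set E) w :
  s \in I -> T \in I -> s <= T -> 0 <= \1_A (X t w) * Z s T w.
Proof. by move=> sI TI sT; rewrite mulr_ge0// Z_ge0. Qed.

Lemma tilted_le_Ex (s t T : R) (A : set E) (x : E) :
  s \in I -> t \in I -> T \in I -> s <= T -> measurable A ->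
  (Ex P s x (fun w => (\1_A (X t w) * Z s T w)%:E) <= (weight s T x)%:E)%E.
Proof.
move=> sI tI TI sT mA; rewrite -weightE//; apply: ge0_le_integral => //.
- by move=> w _; rewrite lee_fin indicZ_ge0.
- by apply/measurable_EFinP; exact: measurable_indicZ.
- by apply/measurable_EFinP; exact: measurable_Z.
- by move=> w _; rewrite lee_fin -[leRHS]mul1r ler_wpM2r ?Z_ge0.
Qed.

Lemma tiltedE (s t T : R) (A : set E) (x : E) :
  s \in I -> t \in I -> T \in I -> s <= T -> measurable A ->
  Ex P s x (fun w => (\1_A (X t w) * Z s T w)%:E) = (tilted s t T A x)%:E.
Proof.
move=> sI tI TI sT mA; rewrite /tilted fineK//.
rewrite ge0_fin_numE ?(le_lt_trans (tilted_le_Ex _ _ _ _ _ _)) ?ltry//.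
by apply: integral_ge0 => w _; rewrite lee_fin indicZ_ge0.
Qed.

Lemma tilted_ge0 (s t T : R) (A : set E) (x : E) :
  s \in I -> T \in I -> s <= T -> 0 <= tilted s t T A x.
Proof.
move=> sI TI sT; apply: fine_ge0.
by apply: integral_ge0 => w _; rewrite lee_fin indicZ_ge0.
Qed.

Lemma tilted_le (s t T : R) (A : set E) (x : E) :
  s \in I -> t \in I -> T \in I -> s <= T -> measurable A ->
  tilted s t T A x <= weight s T x.
Proof. by move=> *; rewrite -lee_fin -tiltedE// tilted_le_Ex. Qed.

Lemma tilted_setT (s t T : R) (x : E) : tilted s t T setT x = weight s T x.
Proof.
rewrite /tilted /weight; congr (fine (Ex P s x _)); apply/funext => w.
by rewrite indicT mul1r.
Qed.

Lemma measurable_tilted (s t T : R) (A : set E) :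
  s \in I -> t \in I -> T \in I -> s <= T -> measurable A ->
  measurable_fun setT (tilted s t T A).
Proof.
move=> sI tI TI sT mA; apply: measurable_fine_Ex => //.
  exact: measurable_indicZ.
by move=> w; exact: indicZ_ge0.
Qed.

(** * Normalised transitions and the averaging identity *)

Lemma ge0_functional_step (s u : R) (x : E) : s \in I -> u \in I -> s <= u ->
  ge0_functional (step s u x).
Proof.
move=> sI uI su; apply: (ge0_functional_comp (measurable_X uI)
  (Phi := fun f => (\int[P s x]_w ((Z s u w / weight s u x)%:E * f w))%E)).
apply: (ge0_functional_mul (g := fun w => Z s u w / weight s u x)).
- by apply: measurable_funM => //; exact: measurable_Z.
- by move=> w; rewrite divr_ge0 ?Z_ge0// ltW// weight_gt0.
- exact: ge0_functional_integral.
Qed.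

Lemma stepE (s u : R) (x : E) (f : E -> R) : s \in I -> u \in I -> s <= u ->
  measurable_fun setT f -> (forall y, 0 <= f y) ->
  Ex P s x (fun w => (Z s u w * f (X u w))%:E) =
  ((weight s u x)%:E * step s u x (fun y => (f y)%:E))%E.
Proof.
move=> sI uI su mf f0; have W0 := weight_gt0 x sI uI su.
have mfX : measurable_fun setT (fun w => f (X u w)).
  by apply: (measurableT_comp mf); exact: measurable_X.
rewrite /step -ge0_integralZl_EFin//; last 3 first.
- by move=> w _; rewrite -EFinM lee_fin mulr_ge0// divr_ge0 ?Z_ge0// ltW.
- apply/measurable_EFinP; apply: measurable_funM => //.
  by apply: measurable_funM => //; exact: measurable_Z.
- exact: ltW.
apply: eq_integral => w _; rewrite -!EFinM; congr EFin.
by field; rewrite gt_eqF.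
Qed.

Lemma step1 (s u : R) (x : E) : s \in I -> u \in I -> s <= u ->
  step s u x (fun=> 1%E) = 1%E.
Proof.
move=> sI uI su; have W0 := weight_gt0 x sI uI su.
have := stepE x (f := fun=> 1) sI uI su (measurable_cst _) (fun=> ler01).
under eq_fun do rewrite mulr1; rewrite weightE// => /esym.
move=> /(congr1 (fun y => ((weight s u x)^-1%:E * y)%E)).
by rewrite muleA -!EFinM mulVf ?gt_eqF// mul1e.
Qed.

(** Both factors are measurable for [F u T]; viewing this sigma-algebra as a measurable type makes
    the product rule for measurable functions available. *)
Lemma adapted_indicZ (u t T : R) (A : set E) :
  u \in I -> t \in I -> T \in I -> u <= t -> t <= T -> measurable A ->
  forall B, measurable B -> F u T ((fun w => \1_A (X t w) * Z u T w) @^-1` B).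
Proof.
move=> uI tI TI ut tT mA.
have uT := le_trans ut tT.
have [Fsig [_ [XF [_ [_ [_ [_ ZF _ _ _]]]]]]] := PM.
have [sig _] := Fsig _ _ uI TI uT.
pose TB := g_sigma_algebraType (F u T).
have mTB : (measurable : set (set TB)) = F u T by exact: sigma_algebra_id.
have : measurable_fun (setT : set TB) (fun w => \1_A (X t w) * Z u T w).
  apply: measurable_funM.
    apply: (measurableT_comp (measurable_indic mA)) => _ B mB.
    by rewrite setTI mTB; exact: XF.
  by move=> _ B mB; rewrite setTI mTB; exact: ZF.
by move=> H B mB; have := H measurableT B mB; rewrite setTI mTB.
Qed.

(** Split [Z s T] as [Z s u * Z u T] and apply the Markov property at time [u], with
    [\1_A (X t w) * Z u T w] as the future variable. *)
Lemma tilted_step (s u t T : R) (A : set E) (x : E) :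
  s \in I -> u \in I -> t \in I -> T \in I -> s <= u -> u <= t -> t <= T ->
  measurable A ->
  (tilted s t T A x)%:E =
  ((weight s u x)%:E * step s u x (fun y => (tilted u t T A y)%:E))%E.
Proof.
move=> sI uI tI TI su ut tT mA; have uT := le_trans ut tT.
have sT := le_trans su uT.
have [_ [_ [_ [_ [_ [_ [_ ZF ZM _ _]]]]]]] := PM.
rewrite -stepE//; last 2 first.
- exact: measurable_tilted.
- by move=> y; exact: tilted_ge0.
rewrite -tiltedE//.
rewrite -(@markov_prod s u T x _ (fun w => \1_A (X t w) * Z u T w))//.
- congr (Ex P s x _); apply/funext => w.
  by rewrite mulrCA ZM.
- by move=> B mB; exact: ZF.
- by move=> w; exact: Z_ge0.
- exact: adapted_indicZ.
- by move=> w; exact: indicZ_ge0.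
- by move=> y; rewrite tiltedE.
Qed.

(* K^T_{s,t} 1_A (x) *)
Definition ratio (s t T : R) (A : set E) (x : E) : R :=
  tilted s t T A x / weight s T x.

Lemma measurable_ratio (s t T : R) (A : set E) :
  s \in I -> t \in I -> T \in I -> s <= T -> measurable A ->
  measurable_fun setT (ratio s t T A).
Proof.
move=> sI tI TI sT mA; apply: measurable_funM; first exact: measurable_tilted.
(* The weights are positive, so the inverse is a power, and powers are measurable. *)
have -> : (fun x => (weight s T x)^-1) = (fun x => weight s T x `^ (-1)).
  by apply/funext => x; rewrite powR_inv1// ltW// weight_gt0.
exact: (measurableT_comp (measurable_powR (-1)) (measurable_weight sI TI sT)).
Qed.

Lemma ratio_itv01 (s t T : R) (A : set E) (x : E) :
  s \in I -> t \in I -> T \in I -> s <= T -> measurable A ->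
  0 <= ratio s t T A x <= 1.
Proof.
move=> sI tI TI sT mA; have W0 := weight_gt0 x sI TI sT.
rewrite divr_ge0 ?tilted_ge0 ?(ltW W0)//=.
by rewrite ler_pdivrMr// mul1r tilted_le.
Qed.

(** The averaging identity: [tilted_step] applied to [A] and to the whole space gives numerator and
    denominator, and the common factor [weight s u x] cancels. The integrals of the two gaps are
    recorded for the contraction argument. *)
Lemma ratio_step (s u t T a b : R) (A : set E) (x : E) :
  s \in I -> u \in I -> t \in I -> T \in I -> s <= u -> u <= t -> t <= T ->
  measurable A -> 0 <= a -> (forall y, a <= ratio u t T A y <= b) ->
  exists G K : R, [/\ step s u x (fun y => (weight u T y)%:E) = G%:E,
    step s u x (fun y => ((b - ratio u t T A y) * weight u T y)%:E) = (b * G - K)%:E,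
    step s u x (fun y => ((ratio u t T A y - a) * weight u T y)%:E) = (K - a * G)%:E,
    0 < G /\ a * G <= K <= b * G & ratio s t T A x = K / G].
Proof.
move=> sI uI tI TI su ut tT mA a0 rab; have uT := le_trans ut tT.
have sT := le_trans su uT.
have [M wM] := weight_bounded uI TI uT.
have fin : step s u x (fun=> 1%E) \is a fin_num by rewrite step1.
have [G [K [EG EK EU EV GK]]] := ge0_functional_between
  (ge0_functional_step x sI uI su) fin (measurable_weight uI TI uT) wM
  (measurable_ratio uI tI TI uT mA) a0 rab.
have W0 := weight_gt0 x sI uI su.
have wE : weight s T x = weight s u x * G.
  apply: EFin_inj; rewrite EFinM -EG -(tilted_setT s u).
  rewrite (tilted_step x sI uI uI TI su (lexx u) uT measurableT).
  by under eq_fun do rewrite tilted_setT.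
have tE : tilted s t T A x = weight s u x * K.
  apply: EFin_inj; rewrite EFinM -EK.
  rewrite (tilted_step x sI uI tI TI su ut tT mA).
  congr (_ * step s u x _)%E; apply/funext => y; congr EFin.
  by rewrite /ratio divfK// gt_eqF// weight_gt0.
exists G, K; split => //.
  split => //; have := weight_gt0 x sI TI sT.
  by rewrite wE pmulr_rgt0.
by rewrite /ratio wE tE -mulf_div divff ?mul1r// gt_eqF.
Qed.

Lemma ratio_step_itv (s u t T a b : R) (A : set E) (x : E) :
  s \in I -> u \in I -> t \in I -> T \in I -> s <= u -> u <= t -> t <= T ->
  measurable A -> 0 <= a -> (forall y, a <= ratio u t T A y <= b) ->
  a <= ratio s t T A x <= b.
Proof.
move=> sI uI tI TI su ut tT mA a0 rab.
have [G [K [_ _ _ [G0 GK] ->]]] := ratio_step x sI uI tI TI su ut tT mA a0 rab.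
by rewrite ler_pdivlMr// ler_pdivrMr.
Qed.

(** * The minorisation constant and one-step contraction *)

Lemma Phi_dirac (s u : R) (x : E) (A : set E) :
  s \in I -> u \in I -> s <= u -> measurable A ->
  Phi P X Z s u (\d_x) A = step s u x (fun y => (\1_A y)%:E).
Proof.
move=> sI uI su mA; have W0 := weight_gt0 x sI uI su.
rewrite /Phi /Exmu !integral_dirac//; first last.
- apply: measurable_Ex => //; first by apply/measurable_EFinP; exact: measurable_indicZ.
  by move=> w; rewrite lee_fin indicZ_ge0.
- apply: measurable_Ex => //; first by apply/measurable_EFinP; exact: measurable_Z.
  by move=> w; rewrite lee_fin Z_ge0.
rewrite diracT !mul1e weightE// inver gt_eqF//.
under eq_fun do rewrite mulrC.
rewrite (stepE x (f := \1_A))//.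
by rewrite muleAC -EFinM divff ?gt_eqF// mul1e.
Qed.

(** [meas_min_exists] needs genuine measures. This one is the image under [X u] of the law [P s x]
    with density [Z s u / weight s u x]. *)
Lemma step_probability (s u : R) (x : E) : s \in I -> u \in I -> s <= u ->
  exists m : probability E R, forall A, measurable A ->
    m A = step s u x (fun y => (\1_A y)%:E).
Proof.
move=> sI uI su; have W0 := weight_gt0 x sI uI su.
have mX := measurable_X uI.
have mXA A : measurable A -> measurable (X u @^-1` A).
  by move=> mA; rewrite -[X in measurable X]setTI; exact: mX.
pose h w : \bar R := (Z s u w / weight s u x)%:E.
have h0 w : (0 <= h w)%E by rewrite lee_fin divr_ge0 ?Z_ge0// ltW.
have mh : measurable_fun setT h.
  by apply/measurable_EFinP; apply: measurable_funM => //; exact: measurable_Z.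
pose m (A : set E) : \bar R := (\int[P s x]_(w in X u @^-1` A) h w)%E.
have mE A : measurable A -> m A = step s u x (fun y => (\1_A y)%:E).
  move=> mA; rewrite /m /step -integral_indicM; last exact: mXA.
  by apply: eq_integral => w _; rewrite muleC.
have m0 : m set0 = 0%E by rewrite /m preimage_set0 integral_set0.
have mge0 A : (0 <= m A)%E by apply: integral_ge0.
have msig : semi_sigma_additive m.
  move=> B mB tB mUB; rewrite /m preimage_bigcup.
  rewrite ge0_integral_bigcup//.
  - by apply: is_cvg_ereal_nneg_natsum => n _; exact: mge0.
  - by move=> k; exact: mXA.
  - by apply: measurable_funTS.
  - apply/trivIsetP => i j _ _ ij; rewrite -preimage_setI.
    by move/trivIsetP: tB => ->//; rewrite preimage_set0.
have m1 : m setT = 1%E.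
  rewrite mE// -(step1 x sI uI su); congr step; apply/funext => y.
  by rewrite indicT.
pose mm : {measure set E -> \bar R} := HB.pack m (isMeasure.Build _ _ _ m m0 mge0 msig).
pose mp : probability E R := HB.pack m mm (Measure_isProbability.Build _ _ _ mm m1).
by exists mp.
Qed.

(** Extracts from the infimum what the contraction needs at one horizon: a common minorant [nu], the
    supremum [S] of the weights, and the lower bound [d * S] on the weight that [nu] carries. *)
Lemma dcoefP (u T : R) (x1 x2 : E) :
  u - 1 \in I -> u \in I -> T \in I -> u <= T ->
  exists (d S : R) (nu : {measure set E -> \bar R}),
  [/\ dcoef discrete P X Z u = d%:E,
      forall A, measurable A -> (nu A <= step (u - 1) u x1 (fun y => (\1_A y)%:E))%E,
      forall A, measurable A -> (nu A <= step (u - 1) u x2 (fun y => (\1_A y)%:E))%E,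
      0 < S /\ (forall y, weight u T y <= S) &
      ((d * S)%:E <= \int[nu]_y (weight u T y)%:E)%E].
Proof.
move=> u1I uI TI uT; have u1u : u - 1 <= u by rewrite gerBl.
have [m1 m1E] := step_probability x1 u1I uI u1u.
have [m2 m2E] := step_probability x2 u1I uI u1u.
have [nu [nule numax]] := meas_min_exists m1 m2.
have P1 A : measurable A -> Phi P X Z (u - 1) u (\d_x1) A = m1 A.
  by move=> mA; rewrite Phi_dirac// m1E.
have P2 A : measurable A -> Phi P X Z (u - 1) u (\d_x2) A = m2 A.
  by move=> mA; rewrite Phi_dirac// m2E.
have nu_min : is_meas_min nu (Phi P X Z (u - 1) u (\d_x1))
                             (Phi P X Z (u - 1) u (\d_x2)).
  split=> [A mA|nu' nu'le A mA]; first by rewrite P1// P2//; exact: nule.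
  by apply: numax => // B mB; have := nu'le B mB; rewrite P1// P2.
set B := ereal_sup [set Ex P u y (fun w => (Z u T w)%:E) | y in setT].
have [M wM] := weight_bounded uI TI uT.
have BM : (B <= M%:E)%E.
  apply: ge_ereal_sup => _ [y _ <-]; rewrite weightE// lee_fin.
  by case/andP: (wM y).
have wB y : ((weight u T y)%:E <= B)%E.
  by rewrite -weightE//; apply: ereal_sup_ubound; exists y.
have B0 : (0 < B)%E.
  by apply: lt_le_trans (wB point); rewrite lte_fin weight_gt0.
have Bfin : B \is a fin_num by rewrite gt0_fin_numE// (le_lt_trans BM)// ltry.
have S0 : 0 < fine B by rewrite fine_gt0// B0/= (le_lt_trans BM)// ltry.
have nu1 : (nu setT <= 1)%E.
  by rewrite -(probability_setT m1); have [] := nule _ measurableT.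
have M0 : 0 <= M by have /andP[] := wM point; exact: le_trans.
have [G G0 EG] := integral_bounded_EFin nu1 (measurable_weight uI TI uT) wM M0.
have dle : (dcoef discrete P X Z u <= (G / fine B)%:E)%E.
  (* [dcoef] ranges over durations, so the horizon [T] enters as the duration [T - u]. *)
  apply: ereal_inf_lbound; exists (T - u), x1, x2, nu; split => //.
    exact: ItimeB.
  rewrite /Exmu (_ : u + (T - u) = T); last by ring.
  under eq_integral do rewrite weightE//.
  by rewrite EG -/B -(fineK Bfin) inver gt_eqF.
(* With the upper bound [dle] this makes the infimum finite. *)
have dge : (0 <= dcoef discrete P X Z u)%E.
  apply: le_ereal_inf_tmp => _ [r [y1 [y2 [n [rI _ ->]]]]].
  have ur : u <= u + r.
    rewrite lerDl; move: rI; rewrite /Itime; case: discrete; rewrite inE//=.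
    by move=> [k ->].
  have urI : u + r \in I.
    move: uI rI; rewrite /Itime; case: discrete; rewrite !inE/=; last exact: addr_ge0.
    by move=> [k ->] [l ->]; exists (k + l)%N; rewrite natrD.
  have Exge0 y : (0 <= Ex P u y (fun w => (Z u (u + r) w)%:E))%E.
    by apply: integral_ge0 => w _; rewrite lee_fin Z_ge0.
  apply: mule_ge0; first by apply: integral_ge0 => y _; exact: Exge0.
  rewrite inve_ge0; apply: le_ereal_sup_tmp.
  exists (Ex P u point (fun w => (Z u (u + r) w)%:E)); last exact: Exge0.
  by exists point.
have dfin : dcoef discrete P X Z u \is a fin_num.
  by rewrite ge0_fin_numE// (le_lt_trans dle)// ltry.
exists (fine (dcoef discrete P X Z u)), (fine B), nu; split => //.
- by rewrite fineK.
- by move=> A mA; rewrite -m1E//; have [] := nule A mA.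
- by move=> A mA; rewrite -m2E//; have [] := nule A mA.
- by split => // y; rewrite -lee_fin (fineK Bfin).
- by rewrite EG lee_fin -ler_pdivlMr// -lee_fin (fineK dfin).
Qed.

Lemma dcoef_fin_num (u : R) : u - 1 \in I -> u \in I ->
  dcoef discrete P X Z u \is a fin_num.
Proof.
move=> u1I uI.
by have [d [S [nu [-> _ _ _ _]]]] := dcoefP point point u1I uI uI (lexx u).
Qed.

(* The kernels started from x1 and x2 share the mass of nu weighted by
   weight u T / S, which is at least dcoef u. *)
Lemma ratio_contract (u t T a c : R) (A : set E) (x1 x2 : E) :
  u - 1 \in I -> u \in I -> t \in I -> T \in I -> u <= t -> t <= T ->
  measurable A -> 0 <= a -> (forall y, a <= ratio u t T A y <= a + c) ->
  ratio (u - 1) t T A x1 <=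
  ratio (u - 1) t T A x2 + c * (1 - fine (dcoef discrete P X Z u)).
Proof.
move=> u1I uI tI TI ut tT mA a0 rac; have uT := le_trans ut tT.
have u1u : u - 1 <= u by rewrite gerBl.
have [d [S [nu [-> nu1 nu2 [S0 wS] dG]]]] := dcoefP x1 x2 u1I uI TI uT.
have [G1 [K1 [EG1 EU1 _ [G10 _] ->]]] :=
  ratio_step x1 u1I uI tI TI u1u ut tT mA a0 rac.
have [G2 [K2 [EG2 _ EV2 [G20 _] ->]]] :=
  ratio_step x2 u1I uI tI TI u1u ut tT mA a0 rac.
have [M wM] := weight_bounded uI TI uT.
have mw := measurable_weight uI TI uT.
have mr := measurable_ratio uI tI TI uT mA.
have nuF := ge0_functional_integral nu.
have nufin : (\int[nu]__ 1)%E \is a fin_num.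
  rewrite integral_cst// mul1e ge0_fin_numE//.
  apply: le_lt_trans (nu1 _ measurableT) _.
  by under eq_fun do rewrite indicT; rewrite step1// ltry.
have [G [K [EG _ EU EV GK]]] := ge0_functional_between nuF nufin mw wM mr a0 rac.
have stepF x := ge0_functional_step x u1I uI u1u.
have nu_le x (f : E -> R) :
    (forall A, measurable A -> (nu A <= step (u - 1) u x (fun y => (\1_A y)%:E))%E) ->
    measurable_fun setT f -> (forall y, 0 <= f y) ->
    (\int[nu]_y (f y)%:E <= step (u - 1) u x (fun y => (f y)%:E))%E.
  move=> le mf f0.
  apply: (le_ge0_functional (f := fun y => (f y)%:E) nuF (stepF x)).
  - by move=> B mB; rewrite integral_indic// setIT; exact: le.
  - exact/measurable_EFinP.
  - by move=> y; rewrite lee_fin.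
have w0 y : 0 <= weight u T y by case/andP: (wM y).
(* [step] has total mass 1, so it sends the constant [S] to [S], which is the image of the weight
   plus that of the nonnegative remainder. *)
have GS x G' : step (u - 1) u x (fun y => (weight u T y)%:E) = G'%:E -> G' <= S.
  move=> EG'; rewrite -lee_fin -EG'.
  have [sD sZ s0 _] := stepF x.
  have <- : step (u - 1) u x (fun y => S%:E * 1)%E = S%:E.
    by rewrite sZ//; [rewrite step1// mule1|exact: ltW].
  rewrite [leRHS](_ : _ = step (u - 1) u x (fun y => (weight u T y)%:E) +
      step (u - 1) u x (fun y => (S - weight u T y)%:E))%E; last first.
    rewrite -sD.
    - by congr step; apply/funext => y; rewrite mule1 -EFinD; congr EFin; ring.
    - exact/measurable_EFinP.
    - by move=> y; rewrite lee_fin.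
    - by apply/measurable_EFinP; apply: measurable_funB.
    - by move=> y; rewrite lee_fin subr_ge0.
  apply: leeDl; apply: s0.
  - by apply/measurable_EFinP; apply: measurable_funB.
  - by move=> y; rewrite lee_fin subr_ge0.
have G1S := GS _ _ EG1; have G2S := GS _ _ EG2.
(* The minorant is used on the upper gap for [x1] and on the lower gap for [x2]; both gaps are
   nonnegative. *)
have U1 : (a + c) * G - K <= (a + c) * G1 - K1.
  rewrite -lee_fin -EU1 -EU; apply: nu_le => //.
    by apply: measurable_funM => //; exact: measurable_funB.
  by move=> y; rewrite mulr_ge0// subr_ge0; case/andP: (rac y).
have V2 : K - a * G <= K2 - a * G2.
  rewrite -lee_fin -EV2 -EV; apply: nu_le => //.
    by apply: measurable_funM => //; exact: measurable_funB.
  by move=> y; rewrite mulr_ge0// subr_ge0; case/andP: (rac y).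
have {}dG : d * S <= G by rewrite -lee_fin -EG.
have c0 : 0 <= c by have /andP[] := rac point; lra.
case/andP: GK => aGK KbG.
(* The normalisations [G1] and [G2] are at most [S], so dividing by [S] weakens both bounds to a
   common denominator. *)
have H1 : ((a + c) * G - K) / S <= (a + c) - K1 / G1.
  apply: (@le_trans _ _ (((a + c) * G - K) / G1)).
    by rewrite ler_wpM2l ?subr_ge0// lef_pV2 ?posrE.
  by rewrite ler_pdivrMr// mulrBl divfK ?gt_eqF.
have H2 : (K - a * G) / S <= K2 / G2 - a.
  apply: (@le_trans _ _ ((K - a * G) / G2)).
    by rewrite ler_wpM2l ?subr_ge0// lef_pV2 ?posrE.
  by rewrite ler_pdivrMr// mulrBl divfK ?gt_eqF.
(* The unknown [K] cancels, leaving [c * G / S], and [G] is at least [d * S]. *)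
have H3 : c * d <= ((a + c) * G - K) / S + (K - a * G) / S.
  have -> : ((a + c) * G - K) / S + (K - a * G) / S = c * G / S by ring.
  by rewrite ler_pdivlMr// -mulrA ler_wpM2l.
rewrite /=; lra.
Qed.

(** * Oscillation over several time steps *)

(** Turns the pairwise bound produced by [ratio_contract] into the interval form it takes as input;
    [a] is the infimum of [f]. *)
Lemma oscillation_inf (f : E -> R) (c : R) :
  (forall x, 0 <= f x) -> (forall x y, f x <= f y + c) ->
  exists2 a : R, 0 <= a & forall x, a <= f x <= a + c.
Proof.
move=> f0 fc; pose S := range f.
have S0 : S !=set0 by exists (f point), point.
exists (inf S); first by apply: lb_le_inf => // _ [y _ <-].
move=> x; rewrite ge_inf//=; last by exists x.
  rewrite -lerBlDr; apply: lb_le_inf => // _ [y _ <-].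
  by rewrite lerBlDr.
by exists 0 => _ [y _ <-].
Qed.

(** Induction backwards from [t] in unit steps. At the start values lie in [0, 1], matching the
    empty product; passing from [t - n] to [t - n - 1] contributes the factor with index [n]. *)
Lemma ratio_oscillation (n : nat) (t T : R) (A : set E) :
  t \in I -> T \in I -> n%:R <= t -> t <= T -> measurable A ->
  exists2 a : R, 0 <= a & forall y, a <= ratio (t - n%:R) t T A y <=
    a + \prod_(0 <= k < n) (1 - fine (dcoef discrete P X Z (t - k%:R))).
Proof.
move=> tI TI + tT mA; elim: n => [|n IH] nt.
  exists 0 => // y; rewrite big_nil add0r subr0.
  exact: ratio_itv01.
have nt' : n%:R <= t by apply: le_trans nt; rewrite ler_nat.
have [a a0 ra] := IH nt'.
have uI : t - n%:R \in I by apply: ItimeB => //; exact: Itime_nat.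
have u1I : t - n.+1%:R \in I by apply: ItimeB => //; exact: Itime_nat.
have u1E : t - n%:R - 1 = t - n.+1%:R by rewrite -addn1 natrD; ring.
have n0 : t - n%:R <= t by rewrite gerBl.
apply: oscillation_inf => [x|x y].
  have u1T : t - n.+1%:R <= T by apply: le_trans tT; rewrite gerBl.
  by case/andP: (ratio_itv01 x u1I tI TI u1T mA).
rewrite big_nat_recr//= -u1E.
by apply: (ratio_contract (a := a)) => //; rewrite u1E.
Qed.

(** The integer part of [t - s] is covered by unit steps; over the remaining fraction the averaging
    identity keeps the values in the same interval. *)
Lemma ratio_oscillation_product (s t T : R) (A : set E) :
  s \in I -> t \in I -> T \in I -> 0 <= s -> s <= t -> t <= T -> measurable A ->
  exists2 a : R, 0 <= a & forall y, a <= ratio s t T A y <=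
    a + \prod_(0 <= k < Num.truncn (t - s))
          (1 - fine (dcoef discrete P X Z (t - k%:R))).
Proof.
move=> sI tI TI s0 st tT mA.
have nts : (Num.truncn (t - s))%:R <= t - s by rewrite truncn_le subr_ge0.
have nt : (Num.truncn (t - s))%:R <= t by lra.
have [a a0 ra] := ratio_oscillation tI TI nt tT mA.
exists a => // y.
apply: (@ratio_step_itv s (t - (Num.truncn (t - s))%:R)) => //.
- by apply: ItimeB => //; exact: Itime_nat.
- by lra.
- by rewrite gerBl.
Qed.

(** * Passage to arbitrary initial distributions *)

Lemma muKE (mu : {measure set E -> \bar R}) (s t T : R) (A : set E) :
  s \in I -> t \in I -> T \in I -> s <= T -> measurable A ->
  muK P X Z s t T mu A = (\int[mu]_x (ratio s t T A x)%:E)%E.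
Proof.
move=> sI tI TI sT mA; apply: eq_integral => x _.
by rewrite tiltedE// weightE// inver gt_eqF ?weight_gt0// -EFinM.
Qed.

(** A zero integral would make the weight vanish almost everywhere; it vanishes nowhere, so the
    whole space would be null. *)
Lemma integral_weight_gt0 (mu : probability E R) (s t : R) :
  s \in I -> t \in I -> s <= t -> (0 < \int[mu]_x (weight s t x)%:E)%E.
Proof.
move=> sI tI st; rewrite lt_neqAle integral_ge0 ?andbT; last first.
  by move=> x _; rewrite lee_fin ltW// weight_gt0.
apply/eqP => int0.
have mw : measurable_fun setT (fun x => (weight s t x)%:E).
  by apply/measurable_EFinP; exact: measurable_weight.
have : (\int[mu]_x `|(weight s t x)%:E| = 0)%E.
  rewrite int0; apply: eq_integral => x _.
  by rewrite gee0_abs// lee_fin ltW// weight_gt0.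
move/(ae_eq_integral_abs mu measurableT mw) => [N [mN N0 sub]].
have : N = setT.
  rewrite -subTset => x _; apply: sub => /= /(_ Logic.I) [].
  by apply/eqP; rewrite gt_eqF// weight_gt0.
move=> NT; have := probability_setT mu; rewrite -NT N0 => /esym/eqP.
by rewrite onee_eq0.
Qed.

(** With horizon [t], the value of [Phi] at [A] is the average of [ratio s t t A] under [mu]
    weighted by [weight s t]. *)
Lemma Phi_itv (mu : probability E R) (s t a b : R) (A : set E) :
  s \in I -> t \in I -> s <= t -> measurable A -> 0 <= a ->
  (forall y, a <= ratio s t t A y <= b) ->
  exists2 r : R, Phi P X Z s t mu A = r%:E & a <= r <= b.
Proof.
move=> sI tI st mA a0 rab.
have [M wM] := weight_bounded sI tI st.
have fin : (\int[mu]__ 1)%E \is a fin_num.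
  by rewrite integral_cst// mul1e fin_num_measure.
have [G [K [EG EK _ _ GK]]] := ge0_functional_between
  (ge0_functional_integral mu) fin (measurable_weight sI tI st) wM
  (measurable_ratio sI tI tI st mA) a0 rab.
have G0 : 0 < G by rewrite -lte_fin -EG; exact: integral_weight_gt0.
exists (K / G); last by rewrite ler_pdivlMr// ler_pdivrMr.
rewrite /Phi /Exmu.
under eq_integral do rewrite tiltedE//.
rewrite (_ : (\int[mu]_x (tilted s t t A x)%:E = K%:E)%E); last first.
  rewrite -EK; apply: eq_integral => x _; congr EFin.
  by rewrite /ratio divfK// gt_eqF// weight_gt0.
under eq_integral do rewrite weightE//.
by rewrite EG inver gt_eqF// -EFinM.
Qed.

End process.

Theorem theorem2p1 (R : realType) (dO dE : measure_display)
  (Omega : measurableType dO) (E : measurableType dE) (discrete : bool)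
  (X : R -> Omega -> E) (F : R -> R -> set (set Omega))
  (P : R -> E -> probability Omega R) (Z : R -> R -> Omega -> R) :
  penalized_markov discrete X F P Z ->
  forall (mu1 mu2 : probability E R) (s t T : R),
    s \in Itime discrete -> t \in Itime discrete -> T \in Itime discrete ->
    0 <= s -> s + 1 <= t -> t <= T ->
    (tv (muK P X Z s t T mu1) (muK P X Z s t T mu2) <=
       (\prod_(0 <= k < Num.truncn (t - s))
          (1 - dcoef discrete P X Z (t - k%:R)))%E * tv mu1 mu2)%E /\
    (tv (Phi P X Z s t mu1) (Phi P X Z s t mu2) <=
       2%:E * \prod_(0 <= k < Num.truncn (t - s))
          (1 - dcoef discrete P X Z (t - k%:R)))%E.
Proof.
move=> PM mu1 mu2 s t T sI tI TI s0 st1 tT.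
have st : s <= t by lra.
have sT := le_trans st tT.
set n := Num.truncn (t - s).
have nts : n%:R <= t - s by rewrite truncn_le subr_ge0.
set c := \prod_(0 <= k < n) (1 - fine (dcoef discrete P X Z (t - k%:R))).
(* Each factor is finite: [k < n] gives [k + 1 <= t], so [t - k - 1] is still an admissible time. *)
have -> : (\prod_(0 <= k < n) (1 - dcoef discrete P X Z (t - k%:R)))%E = c%:E.
  rewrite -prodEFin; apply: eq_big_nat => k /andP[_ kn].
  have kt : k.+1%:R <= t by rewrite (@le_trans _ _ n%:R) ?ler_nat//; lra.
  rewrite EFinB fineK//; apply: (dcoef_fin_num PM).
    rewrite (_ : _ - 1 = t - k.+1%:R); last by rewrite -addn1 natrD; ring.
    by apply: ItimeB => //; exact: Itime_nat.
  apply: ItimeB => //; first exact: Itime_nat.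
  by apply: le_trans kt; rewrite ler_nat.
have osc U A : U \in Itime discrete -> t <= U -> measurable A ->
    exists2 a : R, 0 <= a & forall y,
      a <= ratio (X := X) (P := P) (Z := Z) s t U A y <= a + c.
  by move=> UI tU mA; have := ratio_oscillation_product PM sI tI UI s0 st tU mA.
(* The interval from [a] to [a + c] contains a value of [ratio], so it is not empty. *)
have c0 : 0 <= c.
  by have [a _ /(_ point) /andP[]] := osc T setT TI tT measurableT; lra.
(* Second bound first: both values of [Phi] lie in one interval of length [c], and [tv_le] doubles
   it. *)
split; last first.
  rewrite -EFinM; apply: tv_le => A mA.
  have [a a0 ra] := osc t A tI (lexx t) mA.
  have [r1 -> /andP[l1 u1]] := Phi_itv PM mu1 sI tI st mA a0 ra.
  have [r2 -> /andP[l2 u2]] := Phi_itv PM mu2 sI tI st mA a0 ra.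
  by rewrite -EFinB -EFinN !lee_fin; apply/andP; split; lra.
have [D [mD D21 D12]] := Hahn_finite_measures mu1 mu2.
have mDc : measurable (~` D) by exact: measurableC.
pose del := fine (mu1 D) - fine (mu2 D).
have delE : (mu1 D - mu2 D = del%:E)%E.
  by rewrite EFinB !fineK//; exact: fin_num_measure.
have delcE : (mu2 (~` D) - mu1 (~` D) = del%:E)%E.
  rewrite !probability_setC// /del EFinB.
  have /fineK <- : mu1 D \is a fin_num by exact: fin_num_measure.
  have /fineK <- : mu2 D \is a fin_num by exact: fin_num_measure.
  by rewrite -!EFinB; congr EFin; rewrite /=; ring.
(* [del] is the excess of [mu1] over [mu2] on the Hahn set; twice [del] is at most [tv mu1 mu2] by
   [tv_ge]. *)
apply: (@le_trans _ _ (2 * (c * del))%:E).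
  apply: tv_le => A mA; rewrite !(muKE PM)//.
  have [a a0 ra] := osc T A TI tT mA.
  have mr := measurable_ratio PM sI tI TI sT mA.
  have le1 := integral_diff_le mD D21 D12 mr a0 c0 ra.
  have D21' B : measurable B -> B `<=` ~` ~` D -> (mu2 B <= mu1 B)%E.
    by rewrite setCK; exact: D21.
  (* The opposite difference: the two measures are exchanged and the complement of [D] is the Hahn
     set. *)
  have le2 := integral_diff_le mDc D12 D21' mr a0 c0 ra.
  have r01 x := ratio_itv01 PM x sI tI TI sT mA.
  have fin (mu : probability E R) : (mu setT <= 1)%E by rewrite probability_setT.
  have [r1 _ E1] := integral_bounded_EFin (fin mu1) mr r01 ler01.
  have [r2 _ E2] := integral_bounded_EFin (fin mu2) mr r01 ler01.
  move: le1 le2; rewrite delE delcE E1 E2 -!EFinB -EFinM -EFinN !lee_fin => le1 le2.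
  by apply/andP; split; lra.
rewrite mulrCA EFinM; apply: lee_wpmul2l; first by rewrite lee_fin.
by rewrite EFinM -delE; exact: tv_ge.
Qed.
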